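(* Let $k\in\mathbb{K}_N$, $j\in\{1,\dots,m\}$, and let the parameters be chosen as described in the context. Then there is a constant $C>0$, depending on $k,R,M,M^*,\lambda_{j,2}$, such that (at every $x\in\partial B_j$, for any noisy data) $$\|\mathcal{E}^\epsilon(u)-\mathcal{E}(u)\|_2\le C\left(\sum_{\ell=1}^2\left|\mathbf{E}^\epsilon(|v_{j,\ell,k}|^2)-\mathbf{E}(|v_{j,\ell,k}|^2)\right|+\left|\mathbf{E}^\epsilon(|u_{j,k}|^2)-\mathbf{E}(|u_{j,k}|^2)\right|\right),$$ where $\|\cdot\|_2$ is the Euclidean norm on $\mathbb{R}^2$.
   Context: Let $a>0$, $\Omega_0=(-a,a)^2$, and let $g,\sigma$ be real functions with compact support in $\Omega_0$, $\sigma\ge0$, $g\in L^2(\Omega_0)$, $\sigma\in L^4(\Omega_0)$. Let $G_k(x,y)=-\frac{\mathrm i}{4}H_0^{(1)}(k|x-y|)$, with $H_0^{(1)}=J_0+\mathrm iY_0$ the Hankel function of the first kind of order zero. The radiated random field (the mild solution of $\Delta u+k^2u=g+\sigma\dot W_x$ in $\mathbb{R}^2$ with the Sommerfeld radiation condition, $\dot W_x$ being white noise) is $$u(x,k)=\int_{\Omega_0}G_k(x,y)g(y)\,\mathrm dy+\int_{\Omega_0}G_k(x,y)\sigma(y)\,\mathrm dW_y.$$ Parameters: $m\ge10$ is an integer, $\tau\ge6$, $k^*=\frac{\pi}{30a}$, $\lambda_{j,1}=\frac12$, and $\mathbb{K}_N=\{\frac{\pi}{a}t:t\in\mathbb{R},t\ge1\}\cup\{k^*\}$.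 If $k\in\mathbb{K}_N\setminus\{k^*\}$, then $R=\tau a$ and $\lambda_{j,2}=\frac12+\frac{\pi}{2kR}$; if $k=k^*$, then $R=6a$ and $\lambda_{j,2}=-\frac32$. Also $M=\frac{20\tau-7}{20\tau}$, $M^*=\frac49$. Geometry: $\nu_s=s\pi/m$; $\partial B_j=\{R(\cos\theta,\sin\theta):\nu_{2j-2}\le\theta\le\nu_{2j}\}$; $z_{j,\ell}=\lambda_{j,\ell}R(\cos\nu_{2j-1},\sin\nu_{2j-1})$, $\ell=1,2$; $r_{j,\ell}=|x-z_{j,\ell}|$ for $x\in\partial B_j$. Write $u_{j,k}=u(\cdot,k)|_{\partial B_j}$ and $v_{j,\ell,k}=(u(\cdot,k)+G_k(\cdot,z_{j,\ell}))|_{\partial B_j}$. Exact and noisy quantities: $\mathbf{E}$ is expectation. $\mathbf{E}^\epsilon(|u_{j,k}|^2)$ and $\mathbf{E}^\epsilon(|v_{j,\ell,k}|^2)$ denote given real-valued noisy measurements (functions on $\partial B_j$) of $\mathbf{E}(|u_{j,k}|^2)$ and $\mathbf{E}(|v_{j,\ell,k}|^2)$. Put $$f^\epsilon_{j,\ell,k}=2\left(\mathbf{E}^\epsilon(|v_{j,\ell,k}|^2)-\mathbf{E}^\epsilon(|u_{j,k}|^2)\right)-\tfrac18\left|H_0^{(1)}(kr_{j,\ell})\right|^2,\quad \ell=1,2.$$ The vector $\mathcal{E}(u)=(\mathbf{E}(\operatorname{Re}u_{j,k}),\mathbf{E}(\operatorname{Im}u_{j,k}))^\top$ is the exact mean,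 and $\mathcal{E}^\epsilon(u)=(\mathbf{E}^\epsilon(\operatorname{Re}u_{j,k}),\mathbf{E}^\epsilon(\operatorname{Im}u_{j,k}))^\top$ is, pointwise in $x\in\partial B_j$, the solution of the linear system $$Y_0(kr_{j,\ell})\,\mathbf{E}^\epsilon(\operatorname{Re}u_{j,k})-J_0(kr_{j,\ell})\,\mathbf{E}^\epsilon(\operatorname{Im}u_{j,k})=f^\epsilon_{j,\ell,k},\quad \ell=1,2.$$ *)

(* Defs.v *)
From HB Require Import structures.
From mathcomp Require Import all_boot all_order all_algebra.
From mathcomp Require Import all_classical all_reals all_analysis.
From mathcomp Require Import complex.

Set Implicit Arguments.
Unset Strict Implicit.
Unset Printing Implicit Defensive.

Import Order.TTheory GRing.Theory Num.Theory.
Import numFieldNormedType.Exports.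

Local Open Scope classical_set_scope.
Local Open Scope ring_scope.

(* Points of the plane are pairs. The library norm on R * R is the sup norm,
   hence the separate Euclidean norm and distance. *)
Definition norm2 (R : realType) (x : R * R) : R :=
  Num.sqrt (x.1 ^+ 2 + x.2 ^+ 2).

Definition dist2 (R : realType) (x y : R * R) : R := norm2 (x - y).

(* Bessel functions of order zero on the positive reals, by their power series
   (DLMF 10.2.2 and 10.8.2); Y0 is only meaningful for positive arguments. *)
Definition harmonic_number (R : realType) (n : nat) : R :=
  \sum_(1 <= i < n.+1) i%:R^-1.

Definition euler_gamma (R : realType) : R :=
  limn (fun n => harmonic_number R n - ln n%:R).

Definition bessel_coeff (R : realType) (t : R) (n : nat) : R :=
  (-1) ^+ n * (t / 2) ^+ n.*2 / (n`!%:R ^+ 2).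

Definition besselJ0 (R : realType) (t : R) : R :=
  limn (series (bessel_coeff t)).

Definition besselY0 (R : realType) (t : R) : R :=
  2 / pi * ((ln (t / 2) + euler_gamma R) * besselJ0 t
    - limn (series (fun n => harmonic_number R n * bessel_coeff t n))).

Definition hankel0 (R : realType) (t : R) : R[i] :=
  Complex (besselJ0 t) (besselY0 t).

Definition green (R : realType) (k : R) (x y : R * R) : R[i] :=
  - (Complex 0 1 / 4) * hankel0 (k * dist2 x y).

Definition leb2 (R : realType) :
    {measure set (measurableTypeR R * measurableTypeR R) -> \bar R} :=
  (@lebesgue_measure R \x @lebesgue_measure R)%E.
Arguments leb2 : clear implicits.

(* The Dirac case is separate because [normal_prob m 0] is not a point mass in
   the library. *)
Definition gaussian d (T : measurableType d) (R : realType)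
    (P : probability T R) (X : T -> R) : Prop :=
  exists m s : R, forall A : set R, measurable A ->
    pushforward P X A = if s == 0 then (\d_m A)%E else normal_prob m s A.

Definition L2 (R : realType) (h : R * R -> R) : Prop :=
  h \in Lfun (leb2 R) 2%:E.

Definition L4 (R : realType) (h : R * R -> R) : Prop :=
  h \in Lfun (leb2 R) 4%:E.

(* An isonormal Gaussian process on L^2(R^2): [W h] is the stochastic integral of
   h over the plane, so the integral of h over D is [W (h \_ D)]. The values of W
   outside L^2 are unconstrained. *)
Definition white_noise d (T : measurableType d) (R : realType)
    (P : probability T R) (W : (R * R -> R) -> {RV P >-> R}) : Prop :=
  [/\ forall (n : nat) (c : 'I_n -> R) (h : 'I_n -> R * R -> R),
        (forall i, L2 (h i)) ->
        gaussian P (fun w => \sum_(i < n) c i * W (h i) w),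
      forall h, L2 h -> ('E_P[W h] = 0)%E &
      forall h h', L2 h -> L2 h' ->
        ('E_P[(fun w => W h w * W h' w)%R] =
          \int[leb2 R]_y (h y * h' y)%:E)%E].

Definition cintegral (R : realType) (D : set (R * R)) (f : R * R -> R[i]) :
    R[i] :=
  Complex (\int[leb2 R]_(y in D) complex.Re (f y))
          (\int[leb2 R]_(y in D) complex.Im (f y)).

Definition cstochastic_integral d (T : measurableType d) (R : realType)
    (P : probability T R) (W : (R * R -> R) -> {RV P >-> R})
    (D : set (R * R)) (f : R * R -> R[i]) (w : T) : R[i] :=
  Complex (W ((fun y => complex.Re (f y)) \_ D) w)
          (W ((fun y => complex.Im (f y)) \_ D) w).

Definition Omega0 (R : realType) (a : R) : set (R * R) :=
  [set y | - a < y.1 < a /\ - a < y.2 < a].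

Definition compact_support_in (R : realType) (D : set (R * R))
    (f : R * R -> R) : Prop :=
  compact (closure [set y | f y != 0]) /\ closure [set y | f y != 0] `<=` D.

Definition radiated_field d (T : measurableType d) (R : realType)
    (P : probability T R) (W : (R * R -> R) -> {RV P >-> R})
    (a : R) (g sigma : R * R -> R) (k : R) (x : R * R) (w : T) : R[i] :=
  cintegral (Omega0 a) (fun y => green k x y * (g y)%:C%C)
  + cstochastic_integral W (Omega0 a)
      (fun y => green k x y * (sigma y)%:C%C) w.

Definition kstar (R : realType) (a : R) : R := pi / (30 * a).

Definition wave_numbers (R : realType) (a : R) : set R :=
  [set pi / a * t | t in [set t | 1 <= t]] `|` [set kstar a].

Definition obs_radius (R : realType) (a tau k : R) : R :=
  if k == kstar a then 6 * a else tau * a.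

Definition lambda2 (R : realType) (a tau k : R) : R :=
  if k == kstar a then - (3 / 2)
  else 1 / 2 + pi / (2 * k * obs_radius a tau k).

(* The source index l = 1, 2 is encoded by the two elements of 'I_2. *)
Definition source_lambda (R : realType) (a tau k : R) (l : 'I_2) : R :=
  if l == ord0 then 1 / 2 else lambda2 a tau k.

Definition Mpar (R : realType) (tau : R) : R := (20 * tau - 7) / (20 * tau).

Definition Mstar (R : realType) : R := 4 / 9.

Definition obs_angle (R : realType) (m s : nat) : R := s%:R * pi / m%:R.

Definition obs_arc (R : realType) (rad : R) (m j : nat) : set (R * R) :=
  [set (rad * cos theta, rad * sin theta)
    | theta in [set theta | obs_angle R m (2 * j - 2)%N <= theta
                              <= obs_angle R m (2 * j)%N]].

Definition point_source (R : realType) (rad lam : R) (m j : nat) : R * R :=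
  (lam * rad * cos (obs_angle R m (2 * j - 1)%N),
   lam * rad * sin (obs_angle R m (2 * j - 1)%N)).

(* Exact expectations of |X|^2, Re X and Im X; [fine] only discards the
   infinite values, which do not occur for square-integrable X. *)
Definition mean_sq d (T : measurableType d) (R : realType)
    (P : probability T R) (X : T -> R[i]) : R :=
  fine ('E_P[(fun w => ComplexField.Normc.normc (X w) ^+ 2)%R])%E.

Definition mean_ReIm d (T : measurableType d) (R : realType)
    (P : probability T R) (X : T -> R[i]) : R * R :=
  (fine ('E_P[(fun w => complex.Re (X w))])%E,
   fine ('E_P[(fun w => complex.Im (X w))])%E).

(* Main.v *)
Require Import Defs.
From HB Require Import structures.
From mathcomp Require Import all_boot all_order all_algebra.
From mathcomp Require Import all_classical all_reals all_analysis.
From mathcomp Require Import measurable_realfun complex.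
From mathcomp Require Import ring lra.

Set Implicit Arguments.
Unset Strict Implicit.
Unset Printing Implicit Defensive.

Import Order.TTheory GRing.Theory Num.Theory.
Import numFieldNormedType.Exports.

Local Open Scope classical_set_scope.
Local Open Scope ring_scope.

(** For a fixed observation point the exact means (E Re u, E Im u) satisfy the
    same 2 x 2 linear system as the reconstructed ones, with exact instead of
    noisy right-hand side: adding the deterministic field G of a point source
    changes E|u|^2 by |G|^2 + 2 (Re G E Re u + Im G E Im u), and G is the Hankel
    function up to a constant ([mean_sq_shift], [exact_phaseless_system]).  This
    needs u to be square integrable, which holds because the observation point
    stays away from the square that carries the noise: there the kernel is
    bounded, so its product with sigma is in L^2 ([radiated_field_Lfun2]).
    Subtracting the two systems, the error solves a 2 x 2 system whose right-hand
    side is controlled by the measurement errors, and Cramer's rule bounds it as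
    soon as the determinant D = J0(s) Y0(t) - J0(t) Y0(s), with s, t = k r_1, k r_2,
    is bounded away from zero ([two_by_two_stability]).

    The determinant does not vanish because of Sturm's comparison theorem.  As a
    function of its second argument D is a solution y of Bessel's equation with
    y(s) = 0, and sqrt(t) y solves w'' + (1 + 1/(4 t^2)) w = 0.  On [a, oo) two
    zeros of w are therefore at distance at least pi / q, as soon as
    q^2 > 1 + 1/(4 a^2) ([bessel_ode_gap], [cross_product_neq0]).  The parameters
    are chosen so that s and t are different but closer than that: for k >= pi / a
    both are at least 1 and at distance at most pi / 2, and for k = k* both are
    at least pi / 10 and at distance at most 2 pi / 5 ([cross_product_high],
    [cross_product_low]).  That a solution and its derivative do not vanish
    together comes from the Wronskian t (J0 Y0' - J0' Y0) = 2 / pi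
    ([besselJY_wronskian]), obtained from the power series.

    Finally, s and t only depend on k R, lambda_2 and c = cos phi, where phi is the
    angle between the observation point and the direction of the sources.  As
    |phi| <= pi / m, the number c stays in the compact interval [7/10, 1], whatever
    m >= 10 and j are, so the extreme value theorem gives one constant for all of
    them ([amplification_bound_exists]). *)

(** * Power series with factorially decaying coefficients *)

Section entire_series.
Context {R : realType}.
Implicit Types (a b : R^nat) (x s : R).

(** A growth class that is stable under [pseries_diffs] with the same constant, so
    that every series in it is infinitely differentiable term by term. *)
Definition fact_bounded (C : R) a := forall n, `|a n| <= C / n`!%:R.

Definition pseries_sum a x : R := limn (pseries a x).

Lemma fact_bounded_diffs C a :
  fact_bounded C a -> fact_bounded C (pseries_diffs a).
Proof.
move=> aC n; rewrite /pseries_diffs normrM ger0_norm//.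
have := aC n.+1; rewrite factS natrM.
rewrite invfM mulrCA => /(ler_wpM2l (ler0n R n.+1)) h.
by apply: (le_trans h); rewrite mulVKf// pnatr_eq0.
Qed.

Lemma is_cvg_pseries_sum {C a x} : fact_bounded C a -> cvgn (pseries a x).
Proof.
move=> aC.
have bnd n : `|a n * x ^+ n| <= (C *: exp_coeff `|x|) n.
  rewrite -[leRHS]/(C * (`|x| ^+ n / n`!%:R)) mulrCA normrM normrX mulrC.
  by apply: ler_wpM2l; [exact: exprn_ge0|exact: aC].
apply: normed_cvg.
apply: (@series_le_cvg _ _ (C *: exp_coeff `|x|)) => [n|n|n|].
- exact: normr_ge0.
- exact: le_trans (normr_ge0 _) (bnd n).
- exact: bnd.
- by apply: is_cvg_seriesZ; exact: is_cvg_series_exp_coeff.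
Qed.

Lemma is_derive_pseries_sum C a x : fact_bounded C a ->
  is_derive x 1 (pseries_sum a) (pseries_sum (pseries_diffs a) x).
Proof.
move=> aC; apply: (@pseries_snd_diffs _ _ (`|x| + 1)).
- exact: is_cvg_pseries_sum aC.
- exact: is_cvg_pseries_sum (fact_bounded_diffs aC).
- exact: is_cvg_pseries_sum (fact_bounded_diffs (fact_bounded_diffs aC)).
- by rewrite [ltRHS]ger0_norm ?ltrDl// addr_ge0.
Qed.

(** In terms of functions, this is the operator x d/dx; it turns Bessel's equation
    into a two-term recurrence on coefficients. *)
Lemma pseries_sum_mulX C a x : fact_bounded C a ->
  pseries_sum (fun n => n%:R * a n) x = x * pseries_sum (pseries_diffs a) x.
Proof.
move=> aC; apply/cvg_lim => //.
have h := pseries_diffs_equiv (is_cvg_pseries_sum (x := x) (fact_bounded_diffs aC)).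
rewrite (_ : pseries _ x = cst x \* series (fun i => i%:R * a i * x ^+ i.-1)).
  exact: (cvgM (cvg_cst x) h).
apply/funext => n /=; rewrite /pseries /series /= mulr_sumr.
apply: eq_bigr => -[|i] _; rewrite ?mul0r ?mulr0//.
by rewrite exprS/=; ring.
Qed.

Lemma pseries_sumD C a b x : fact_bounded C a -> fact_bounded C b ->
  pseries_sum (fun n => a n + b n) x = pseries_sum a x + pseries_sum b x.
Proof.
move=> aC bC; rewrite /pseries_sum.
rewrite -(lim_seriesD (is_cvg_pseries_sum (x := x) aC) (is_cvg_pseries_sum (x := x) bC)).
congr (limn (series _)); apply/funext => n.
exact: mulrDl.
Qed.

Lemma pseries_sum0 a : pseries_sum a 0 = a 0%N.
Proof.
apply/cvg_lim => //; apply/cvgrPdist_lt => e e0; near=> n.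
have [m ->] : exists m, n = m.+1.
  by exists n.-1; rewrite prednK //; near: n; exists 1%N.
rewrite /pseries/series/= big_nat_recl// big1_seq => [|i _].
  by rewrite expr0 mulr1 addr0 subrr normr0.
by rewrite exprS mul0r mulr0.
Unshelve. all: by end_near. Qed.

End entire_series.

(** * Bessel's equation and the Wronskian of J0 and Y0 *)

Section bessel.
Context {R : realType}.
Implicit Types (a b : R^nat) (x s t : R).

(** An alias of [is_derive] that is not a type class: derivatives are then built by
    the rules below, in a form that [ring] and [field] can compare. *)
Definition has_deriv (f : R -> R) x v : Prop := is_derive x 1 f v.

Lemma has_deriv_eq (f : R -> R) x u v : has_deriv f x u -> u = v -> has_deriv f x v.
Proof. by move=> + <-. Qed.

Lemma has_deriv_id x : has_deriv (fun t => t) x 1.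
Proof. exact: is_derive_id. Qed.

Lemma has_deriv_cst x c : has_deriv (fun=> c) x 0.
Proof. exact: is_derive_cst. Qed.

Lemma has_derivD (f g : R -> R) x u v : has_deriv f x u ->
  has_deriv g x v -> has_deriv (fun t => f t + g t) x (u + v).
Proof. by move=> fu gv; exact: is_deriveD. Qed.

Lemma has_derivN (f : R -> R) x u : has_deriv f x u ->
  has_deriv (fun t => - f t) x (- u).
Proof. by move=> fu; exact: is_deriveN. Qed.

Lemma has_derivM (f g : R -> R) x u v : has_deriv f x u ->
  has_deriv g x v -> has_deriv (fun t => f t * g t) x (u * g x + f x * v).
Proof.
move=> fu gv; apply: (has_deriv_eq (is_deriveM fu gv)).
by rewrite -![_ *: _]/(_ * _); ring.
Qed.

Lemma has_derivZ (f : R -> R) x c u : has_deriv f x u ->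
  has_deriv (fun t => c * f t) x (c * u).
Proof. by move=> fu; exact: (is_deriveZ c fu). Qed.

Lemma has_deriv_comp (f g : R -> R) x u v : has_deriv f (g x) u ->
  has_deriv g x v -> has_deriv (fun t => f (g t)) x (u * v).
Proof. by move=> fu gv; exact: is_derive1_comp fu gv. Qed.

(** With x = -(t/2)^2 the series of J0 and Y0 become power series in x, and
    (t d/dt) is 2 (x d/dx). *)
Definition bessel_arg t : R := - (t / 2) ^+ 2.

Lemma has_deriv_bessel_arg t : has_deriv bessel_arg t (- (t / 2)).
Proof.
have -> : bessel_arg = (fun t => - (1 / 4) * (t * t)).
  by apply/funext => u; rewrite /bessel_arg; field.
apply: has_deriv_eq.
  by apply: has_derivZ; apply: has_derivM; exact: has_deriv_id.
by rewrite /=; field.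
Qed.

Lemma has_deriv_pseries_sum_arg C a t : fact_bounded C a ->
  has_deriv (fun t => pseries_sum a (bessel_arg t)) t
    (- (t / 2) * pseries_sum (pseries_diffs a) (bessel_arg t)).
Proof.
move=> aC; apply: has_deriv_eq.
  apply: (@has_deriv_comp (pseries_sum a) bessel_arg).
  - exact: is_derive_pseries_sum aC.
  - exact: has_deriv_bessel_arg.
by rewrite mulrC.
Qed.

Definition J0_coef (n : nat) : R := (n`!%:R ^+ 2)^-1.
Definition S_coef (n : nat) : R := harmonic_number R n * J0_coef n.

Lemma fact_boundedJ0 : fact_bounded 1 J0_coef.
Proof.
move=> n; rewrite /J0_coef ger0_norm ?invr_ge0 ?exprn_ge0//.
rewrite div1r lef_pV2 ?posrE ?exprn_gt0 ?ltr0n ?fact_gt0//.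
by rewrite expr2 -natrM ler_nat leq_pmulr// fact_gt0.
Qed.

Lemma harmonic_numberS n :
  harmonic_number R n.+1 = harmonic_number R n + n.+1%:R^-1.
Proof. by rewrite /harmonic_number big_nat_recr. Qed.

Lemma harmonic_number_ge0 n : 0 <= harmonic_number R n.
Proof. by apply: sumr_ge0 => i _; rewrite invr_ge0. Qed.

Lemma harmonic_number_le n : harmonic_number R n <= n%:R.
Proof.
elim: n => [|n ih]; first by rewrite /harmonic_number big_nil.
by rewrite harmonic_numberS -natr1 lerD// invf_le1 ?ltr0n// lerDr.
Qed.

Lemma leq_fact n : (n <= n`!)%N.
Proof. by case: n => // n; rewrite factS leq_pmulr// fact_gt0. Qed.

Lemma leq_sqr_fact n : (n * n <= 2 * n`!)%N.
Proof.
case: n => // n; rewrite factS mulnCA leq_mul2l /=.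
case: n => // n; rewrite factS mulnCA.
case: n => // n; rewrite (@leq_trans (n.+2 * 2))//.
  by rewrite muln2 -addnn addSn addnS ltnS ltnS leq_addr.
by rewrite leq_mul2l /= leq_pmulr// fact_gt0.
Qed.

Lemma fact_boundedS : fact_bounded 1 S_coef.
Proof.
move=> n; rewrite /S_coef /J0_coef ger0_norm; last first.
  by rewrite mulr_ge0 ?harmonic_number_ge0 ?invr_ge0 ?exprn_ge0.
have n0 : 0 < n`!%:R :> R by rewrite ltr0n fact_gt0.
rewrite ler_pdivrMr ?exprn_gt0// expr2 mulrA divfK ?gt_eqF// mul1r.
by rewrite (le_trans (harmonic_number_le n))// ler_nat leq_fact.
Qed.

Lemma fact_bounded_nJ0 : fact_bounded 1 (fun n => n%:R * J0_coef n).
Proof.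
move=> n; rewrite /J0_coef ger0_norm; last first.
  by rewrite mulr_ge0 ?invr_ge0 ?exprn_ge0.
have n0 : 0 < n`!%:R :> R by rewrite ltr0n fact_gt0.
rewrite ler_pdivrMr ?exprn_gt0// expr2 mulrA divfK ?gt_eqF// mul1r.
by rewrite ler_nat leq_fact.
Qed.

Lemma fact_bounded_nS : fact_bounded 2 (fun n => n%:R * S_coef n).
Proof.
move=> n; rewrite /S_coef /J0_coef ger0_norm; last first.
  by rewrite !mulr_ge0 ?harmonic_number_ge0 ?invr_ge0 ?exprn_ge0.
have n0 : 0 < n`!%:R :> R by rewrite ltr0n fact_gt0.
rewrite mulrA ler_pdivrMr ?exprn_gt0// expr2 mulrA divfK ?gt_eqF//.
apply: le_trans (_ : n%:R * n%:R <= _).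
  by rewrite ler_wpM2l// harmonic_number_le.
by rewrite -!natrM ler_nat leq_sqr_fact.
Qed.

(** The series that accompanies the logarithm in Y0. *)
Definition besselS t : R :=
  limn (series (fun n => harmonic_number R n * bessel_coeff t n)).

Lemma besselJ0E t : besselJ0 t = pseries_sum J0_coef (bessel_arg t).
Proof.
congr (limn (series _)); apply/funext => n.
rewrite /bessel_coeff /= /J0_coef /bessel_arg -mul2n exprM.
by rewrite [in RHS]exprNn; ring.
Qed.

Lemma besselSE t : besselS t = pseries_sum S_coef (bessel_arg t).
Proof.
congr (limn (series _)); apply/funext => n.
rewrite /bessel_coeff /= /S_coef /J0_coef /bessel_arg -mul2n exprM.
by rewrite [in RHS]exprNn; ring.
Qed.

Definition dbesselJ0 t : R :=
  - (t / 2) * pseries_sum (pseries_diffs J0_coef) (bessel_arg t).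
Definition dbesselS t : R :=
  - (t / 2) * pseries_sum (pseries_diffs S_coef) (bessel_arg t).

Lemma has_deriv_besselJ0 t : has_deriv (@besselJ0 R) t (dbesselJ0 t).
Proof.
rewrite (_ : @besselJ0 R = fun t => pseries_sum J0_coef (bessel_arg t)).
  exact: has_deriv_pseries_sum_arg fact_boundedJ0.
by apply/funext => u; exact: besselJ0E.
Qed.

Lemma has_deriv_besselS t : has_deriv besselS t (dbesselS t).
Proof.
rewrite (_ : besselS = fun t => pseries_sum S_coef (bessel_arg t)).
  exact: has_deriv_pseries_sum_arg fact_boundedS.
by apply/funext => u; exact: besselSE.
Qed.

(** The coefficients a_n = 1 / n!^2 satisfy (n+1)^2 a_(n+1) = a_n, that is
    (x F')' = F for F(x) = sum a_n x^n, which is Bessel's equation for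
    J0(t) = F(-(t/2)^2). *)
Lemma besselJ0_ode t : has_deriv (fun t => t * dbesselJ0 t) t (- (t * besselJ0 t)).
Proof.
rewrite (_ : (fun t => t * dbesselJ0 t) =
    fun t => 2 * pseries_sum (fun n => n%:R * J0_coef n) (bessel_arg t)).
  apply: has_deriv_eq.
    exact: has_derivZ (has_deriv_pseries_sum_arg _ fact_bounded_nJ0).
  rewrite besselJ0E (_ : pseries_diffs _ = J0_coef); first by field.
  apply/funext => n; rewrite /pseries_diffs /J0_coef factS natrM.
  by field; rewrite nat1r !pnatr_eq0 -lt0n fact_gt0.
apply/funext => u; rewrite (pseries_sum_mulX _ fact_boundedJ0) /dbesselJ0 /bessel_arg.
by field.
Qed.

(** Since h_(n+1) = h_n + 1/(n+1), the coefficients h_n / n!^2 satisfy the recurrence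
    of J0 up to the coefficients of F'; hence the source term 2 J0'. *)
Lemma besselS_ode t : has_deriv (fun t => t * dbesselS t) t
  (2 * dbesselJ0 t - t * besselS t).
Proof.
rewrite (_ : (fun t => t * dbesselS t) =
    fun t => 2 * pseries_sum (fun n => n%:R * S_coef n) (bessel_arg t)).
  apply: has_deriv_eq.
    exact: has_derivZ (has_deriv_pseries_sum_arg _ fact_bounded_nS).
  rewrite besselSE (_ : pseries_diffs _ =
      fun n => S_coef n + pseries_diffs J0_coef n); last first.
    apply/funext => n; rewrite /pseries_diffs /S_coef /J0_coef factS natrM.
    rewrite harmonic_numberS.
    by field; rewrite nat1r !pnatr_eq0 -lt0n fact_gt0.
  rewrite (pseries_sumD _ fact_boundedS (fact_bounded_diffs fact_boundedJ0)).
  by rewrite /dbesselJ0; field.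
apply/funext => u; rewrite (pseries_sum_mulX _ fact_boundedS) /dbesselS /bessel_arg.
by field.
Qed.

Lemma besselJ0_0 : besselJ0 0 = 1 :> R.
Proof.
rewrite besselJ0E /bessel_arg mul0r expr0n oppr0 pseries_sum0 /J0_coef.
by rewrite fact0 expr1n invr1.
Qed.

(** The left-hand side is pi / 2 times t (J0 Y0' - J0' Y0) with the logarithms
    cancelled.  It is smooth at 0, so its constant value can be read off
    there. *)
Lemma besselJS_wronskian t :
  besselJ0 t ^+ 2 + (t * dbesselJ0 t) * besselS t - besselJ0 t * (t * dbesselS t) = 1.
Proof.
pose A t := besselJ0 t * besselJ0 t +
  ((t * dbesselJ0 t) * besselS t + - 1 * (besselJ0 t * (t * dbesselS t))).
have dA u : has_deriv A u 0.
  apply: has_deriv_eq.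
    apply: has_derivD; first by apply: has_derivM; exact: has_deriv_besselJ0.
    apply: has_derivD.
      by apply: has_derivM; [exact: besselJ0_ode|exact: has_deriv_besselS].
    apply: has_derivZ; apply: has_derivM.
      exact: has_deriv_besselJ0.
    exact: besselS_ode.
  by rewrite /=; ring.
have : A t = A 0 by apply: is_derive_0_is_cst => u; exact: dA.
have -> : A 0 = 1 by rewrite /A besselJ0_0; ring.
by move=> <-; rewrite /A; ring.
Qed.

Definition dbesselY0 t : R :=
  2 / pi * (besselJ0 t / t + (ln (t / 2) + euler_gamma R) * dbesselJ0 t - dbesselS t).

Lemma besselY0E t : besselY0 t =
  2 / pi * ((ln (t / 2) + euler_gamma R) * besselJ0 t - besselS t).
Proof. by []. Qed.

Lemma has_deriv_lnhalf t : 0 < t ->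
  has_deriv (fun t => ln (t / 2) + euler_gamma R) t t^-1.
Proof.
move=> t0; apply: has_deriv_eq.
  apply: has_derivD.
    apply: (@has_deriv_comp (@ln R) (fun t => t / 2)).
      by apply: is_derive1_ln; rewrite divr_gt0.
    by apply: has_derivM; [exact: has_deriv_id|exact: has_deriv_cst].
  exact: has_deriv_cst.
by rewrite /=; field; rewrite gt_eqF.
Qed.

Lemma has_deriv_besselY0 t : 0 < t -> has_deriv (@besselY0 R) t (dbesselY0 t).
Proof.
move=> t0; apply: has_deriv_eq.
  apply: has_derivZ; apply: has_derivD.
    apply: has_derivM; first exact: has_deriv_lnhalf.
    exact: has_deriv_besselJ0.
  exact: has_derivN (has_deriv_besselS t).
rewrite /dbesselY0; move: (pi : R) (lt0r_neq0 (pi_gt0 R)) => p p0.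
by field; rewrite gt_eqF.
Qed.

(** The logarithm contributes 2 J0', once at each differentiation, which cancels the
    source term in [besselS_ode]. *)
Lemma besselY0_ode t : 0 < t ->
  has_deriv (fun t => t * dbesselY0 t) t (- (t * besselY0 t)).
Proof.
move=> t0.
have d : has_deriv (fun t => 2 / pi * (besselJ0 t +
   ((ln (t / 2) + euler_gamma R) * (t * dbesselJ0 t) + - 1 * (t * dbesselS t))))
   t (- (t * besselY0 t)).
  apply: has_deriv_eq.
    apply: has_derivZ; apply: has_derivD; first exact: has_deriv_besselJ0.
    apply: has_derivD.
      apply: has_derivM; first exact: has_deriv_lnhalf.
      exact: besselJ0_ode.
    apply: has_derivZ; exact: besselS_ode.
  rewrite besselY0E; move: (pi : R) (lt0r_neq0 (pi_gt0 R)) => p p0.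
  by rewrite /=; field; rewrite p0 gt_eqF.
(* The two functions agree only away from 0, where t (J0 / t) = J0. *)
apply: near_eq_is_derive d.
near=> u; rewrite /dbesselY0; move: (pi : R) (lt0r_neq0 (pi_gt0 R)) => p p0.
field; rewrite p0 gt_eqF//.
by near: u; exact: lt_nbhsr.
Unshelve. all: by end_near. Qed.

Lemma besselJY_wronskian t : 0 < t ->
  t * (besselJ0 t * dbesselY0 t - dbesselJ0 t * besselY0 t) = 2 / pi.
Proof.
move=> t0; have := besselJS_wronskian t; rewrite /dbesselY0 besselY0E => W.
rewrite -[RHS]mulr1 -[X in _ = _ * X]W.
move: (pi : R) (lt0r_neq0 (pi_gt0 R)) => p p0.
by field; rewrite p0 gt_eqF.
Qed.

End bessel.

(** * Sturm comparison for Bessel's equation *)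

Section sturm.
Context {R : realType}.

Lemma has_deriv_mvt (f df : R -> R) a b : a < b ->
  (forall t, a <= t <= b -> has_deriv f t (df t)) ->
  exists2 c, a < c < b & f b - f a = df c * (b - a).
Proof.
move=> ab fdf.
have [||c] := @MVT _ f df a b ab.
- by move=> t; rewrite in_itv/= => /andP[ta tb]; apply: fdf; rewrite !ltW.
- apply: derivable_within_continuous => t; rewrite in_itv/= => tab.
  by case: (fdf t tab).
by rewrite in_itv/= => cab fab; exists c.
Qed.

Lemma has_deriv_ge0 (f df : R -> R) a b : a <= b ->
  (forall t, a <= t <= b -> has_deriv f t (df t)) ->
  (forall t, a <= t <= b -> 0 <= df t) -> f a <= f b.
Proof.
rewrite le_eqVlt => /predU1P[->//|ab] fdf df0.
have [c /andP[ac cb] fE] := has_deriv_mvt ab fdf.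
by rewrite -subr_ge0 fE mulr_ge0 ?df0 ?subr_ge0 ?ltW// !ltW.
Qed.

Lemma sin_le_id (x : R) : 0 <= x -> sin x <= x.
Proof.
move=> x0; rewrite -subr_ge0.
have <- : 0 - sin 0 = 0 :> R by rewrite sin0 subr0.
apply: (@has_deriv_ge0 (fun t => t - sin t) (fun t => 1 - cos t)) => // t _.
by apply: has_derivD; [exact: has_deriv_id|apply: has_derivN; exact: is_derive_sin].
Qed.

Lemma cos_ge_quadratic (x : R) : 0 <= x -> 1 - x ^+ 2 / 2 <= cos x.
Proof.
move=> x0; rewrite -subr_ge0 opprB.
have <- : cos 0 + (1 / 2 * (0 * 0) + - 1) = 0 :> R by rewrite cos0; ring.
have -> : cos x + (x ^+ 2 / 2 - 1) = cos x + (1 / 2 * (x * x) + - 1) by field.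
apply: (@has_deriv_ge0 (fun t => cos t + (1 / 2 * (t * t) + - 1))
    (fun t => t - sin t)) => // t /andP[t0 _].
  apply: has_deriv_eq.
    apply: has_derivD; first exact: is_derive_cos.
    apply: has_derivD; last exact: has_deriv_cst.
    by apply: has_derivZ; apply: has_derivM; exact: has_deriv_id.
  by rewrite /=; field.
by rewrite subr_ge0 sin_le_id.
Qed.

(** From 0 = cos (pi / 2) >= 1 - (pi / 2)^2 / 2; the bound 2 <= pi would be too weak
    for [cross_product_low]. *)
Lemma pi_sqr_ge8 : 8 <= (pi : R) ^+ 2.
Proof.
have := @cos_ge_quadratic (pi / 2); rewrite cos_pihalf divr_ge0 ?pi_ge0// => /(_ isT).
rewrite expr_div_n; set p2 := _ ^+ 2; lra.
Qed.

(** Sturm comparison in the Riccati form.  The comparison function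
    cos (q (t - m)), with m the middle of [a, b], has no zero on [a, b] because
    q (b - a) < pi, and P = t z'/z for z = cos (q (t - m)) / sqrt t.  Picone's
    identity writes the derivative of f t f' - P f^2 as a sum of two squares with
    positive weights; this function vanishes at both ends, so by Rolle both squares
    vanish at some interior point. *)
Lemma bessel_ode_gap (f df : R -> R) (a b q : R) :
  0 < a -> a < b -> 0 < q -> q * (b - a) < pi -> 1 + (4 * a ^+ 2)^-1 < q ^+ 2 ->
  (forall t, a <= t <= b -> has_deriv f t (df t)) ->
  (forall t, a <= t <= b -> has_deriv (fun t => t * df t) t (- (t * f t))) ->
  f a = 0 -> f b = 0 ->
  exists2 c, a < c < b & f c = 0 /\ df c = 0.
Proof.
move=> a0 ab q0 qL aq fD ode fa fb.
pose m := (a + b) / 2.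
pose T t := tan (q * (t - m)).
pose P t := - (1 / 2) + - (t * (q * T t)).
have cos_neq0 t : a <= t <= b -> cos (q * (t - m)) != 0.
  move=> /andP[at_ tb]; rewrite gt_eqF// cos_gt0_pihalf// -ltr_norml.
  rewrite normrM (gtr0_norm q0).
  apply: (@le_lt_trans _ _ (q * ((b - a) / 2))); last by rewrite mulrA; lra.
  by rewrite ler_pM2l// ler_norml /m; lra.
have dT t : a <= t <= b -> has_deriv T t (q * (1 + T t ^+ 2)).
  move=> tab; apply: has_deriv_eq.
    apply: (@has_deriv_comp _ tan (fun t => q * (t - m))).
      exact: (is_derive_tan (cos_neq0 _ tab)).
    apply: has_derivZ; apply: has_derivD; first exact: has_deriv_id.
    exact: has_deriv_cst.
  by rewrite /T cos2_tan2 ?cos_neq0//=; ring.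
pose Phi t := f t * (t * df t) + - (P t * (f t * f t)).
(* Picone's identity; the 1/(4 t^2) comes from the factor 1 / sqrt t in z *)
have dPhi t : a <= t <= b -> has_deriv Phi t
    (t * (df t - P t * f t / t) ^+ 2 +
     t * (q ^+ 2 - (1 + (4 * t ^+ 2)^-1)) * f t ^+ 2).
  move=> tab; apply: has_deriv_eq.
    apply: has_derivD; first by apply: has_derivM; [exact: fD|exact: ode].
    apply: has_derivN; apply: has_derivM.
      apply: has_derivD; first exact: has_deriv_cst.
      apply: has_derivN; apply: has_derivM; first exact: has_deriv_id.
      by apply: has_derivZ; exact: dT.
    by apply: has_derivM; exact: fD.
  rewrite /= /P; field; rewrite gt_eqF//.
  by case/andP: tab => /(lt_le_trans a0).
have [c /andP[ac cb]] := has_deriv_mvt ab dPhi.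
rewrite [in LHS]/Phi fa fb !(mul0r, mulr0, subr0) => /esym/eqP.
rewrite mulf_eq0 [X in _ || X]subr_eq0 (gt_eqF ab) orbF => /eqP dc.
have c0 := lt_trans a0 ac.
have qc : 0 < q ^+ 2 - (1 + (4 * c ^+ 2)^-1).
  rewrite subr_gt0 (le_lt_trans _ aq)// lerD2l lef_pV2 ?posrE ?mulr_gt0 ?exprn_gt0//.
  by rewrite ler_pM2l// lerXn2r ?nnegrE ?ltW.
exists c; first by rewrite ac.
have h1 : 0 <= c * (df c - P c * f c / c) ^+ 2.
  by rewrite mulr_ge0 ?sqr_ge0// ltW.
have h2 : 0 <= c * (q ^+ 2 - (1 + (4 * c ^+ 2)^-1)) * f c ^+ 2.
  by rewrite mulr_ge0 ?sqr_ge0// mulr_ge0// ltW.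
have /eqP := dc; rewrite paddr_eq0// !mulf_eq0 (gt_eqF c0) (gt_eqF qc) /= !orbb.
case/andP => + /eqP fc; rewrite fc mulr0 mul0r subr0 => /eqP dfc.
by split.
Qed.

(** The determinant of the phaseless system at the scaled distances s and t. *)
Definition cross_product (s t : R) : R :=
  besselJ0 s * besselY0 t - besselJ0 t * besselY0 s.

(** If it vanished, Y0(a) J0 - J0(a) Y0 would be a solution with zeros a and b, so
    it would vanish together with its derivative at some c; the Wronskian at c then
    forces J0(a) = Y0(a) = 0, against the Wronskian at a. *)
Lemma cross_product_neq0 (a b q : R) :
  0 < a -> a < b -> 0 < q -> q * (b - a) < pi -> 1 + (4 * a ^+ 2)^-1 < q ^+ 2 ->
  cross_product a b != 0.
Proof.
move=> a0 ab q0 qL aq; apply/negP => /eqP ab0.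
have W (t : R) : 0 < t -> besselJ0 t * dbesselY0 t - dbesselJ0 t * besselY0 t != 0.
  move=> t0; apply/eqP => t1.
  have /eqP := besselJY_wronskian t0; rewrite t1 mulr0 eq_sym mulf_eq0 invr_eq0.
  by rewrite gt_eqF//= gt_eqF ?pi_gt0.
pose f t := besselY0 a * besselJ0 t + - besselJ0 a * besselY0 t.
pose df t := besselY0 a * dbesselJ0 t + - besselJ0 a * dbesselY0 t.
have pos t : a <= t <= b -> 0 < t by case/andP => /(lt_le_trans a0).
have [|t tab|||c /andP[ac _] [fc dfc]] := @bessel_ode_gap f df a b q a0 ab q0 qL aq.
- move=> t /pos t0; apply: has_derivD; apply: has_derivZ.
    exact: has_deriv_besselJ0.
  exact: has_deriv_besselY0.
- rewrite (_ : (fun t => t * df t) = fun t => besselY0 a * (t * dbesselJ0 t) +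
    - besselJ0 a * (t * dbesselY0 t)); last by apply/funext => u; rewrite /df; ring.
  apply: has_deriv_eq.
    apply: has_derivD; apply: has_derivZ.
      exact: besselJ0_ode.
    by apply: besselY0_ode; exact: pos tab.
  by rewrite /f; ring.
- by rewrite /f; ring.
- by rewrite /f -[RHS]oppr0 -ab0 /cross_product; ring.
have c0 := lt_trans a0 ac.
have Ja : besselJ0 a = 0.
  apply: (mulIf (W _ c0)); rewrite mul0r.
  transitivity (dbesselJ0 c * f c - besselJ0 c * df c); first by rewrite /f /df; ring.
  by rewrite fc dfc !mulr0 subrr.
have Ya : besselY0 a = 0.
  apply: (mulIf (W _ c0)); rewrite mul0r.
  transitivity (dbesselY0 c * f c - besselY0 c * df c); first by rewrite /f /df; ring.
  by rewrite fc dfc !mulr0 subrr.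
by have /eqP := W _ a0; rewrite Ja Ya !(mul0r, mulr0) subrr.
Qed.

End sturm.

(** * The distances k r_1, k r_2 and the determinant *)

Section geometry.
Context {R : realType}.

(** Law of cosines: the distance between the point of polar radius [rad] and the point
    of radius [lam * rad] whose angles differ by phi, where c = cos phi. *)
Definition arc_dist (rad lam c : R) : R :=
  Num.sqrt (rad ^+ 2 * (1 + lam ^+ 2 - 2 * lam * c)).

Lemma dist2_polar (rad lam theta nu : R) :
  dist2 (rad * cos theta, rad * sin theta)
        (lam * rad * cos nu, lam * rad * sin nu)
  = arc_dist rad lam (cos (theta - nu)).
Proof.
rewrite /dist2 /norm2 /arc_dist /= cosB; congr Num.sqrt.
have e1 := cos2Dsin2 theta; have e2 := cos2Dsin2 nu.
transitivity (rad ^+ 2 * ((cos theta ^+ 2 + sin theta ^+ 2) +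
  lam ^+ 2 * (cos nu ^+ 2 + sin nu ^+ 2) -
  2 * lam * (cos theta * cos nu + sin theta * sin nu))); first by ring.
by rewrite e1 e2 mulr1.
Qed.

Lemma arc_distZ (k rad lam c : R) : 0 < k ->
  k * arc_dist rad lam c = arc_dist (k * rad) lam c.
Proof.
move=> k0; rewrite /arc_dist -[in LHS](gtr0_norm k0) -sqrtr_sqr.
by rewrite -sqrtrM ?sqr_ge0// mulrA exprMn.
Qed.

(** The angle is at most pi / 10 < 2 / 5 in absolute value, and 7 / 10 is a convenient
    lower bound of 1 - (2/5)^2 / 2. *)
Lemma cos_arc_ge (m j : nat) (theta : R) : (10 <= m)%N -> (1 <= j)%N ->
  obs_angle R m (2 * j - 2)%N <= theta <= obs_angle R m (2 * j)%N ->
  7 / 10 <= cos (theta - obs_angle R m (2 * j - 1)%N).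
Proof.
case: j => // j m10 _; rewrite mulnS /obs_angle addKn addSn subn1 [_.+1.-1]/=.
set d := theta - _ => /andP[t1 t2].
pose h : R := pi / m%:R.
have m0 : 0 < m%:R :> R by rewrite ltr0n (leq_trans _ m10).
have h0 : 0 <= h by rewrite divr_ge0 ?pi_ge0// ltW.
have h25 : h <= 2 / 5.
  have : (pi : R) < 4 by have := pihalf_lt2 R; rewrite ltr_pdivrMr//; lra.
  have : 10 <= m%:R :> R by rewrite (ler_nat _ 10).
  by rewrite ler_pdivrMr//; lra.
have dh : `|d| <= h.
  move: t1 t2; rewrite /d -!mulrA -/h !mulSn !natrD.
  by rewrite ler_norml -[(1 + 2 * j)%N]/((2 * j).+1) -natr1; lra.
have -> : cos d = cos `|d| by case: (ger0P d) => _; rewrite ?cosN.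
apply: le_trans (cos_ge_quadratic (normr_ge0 d)).
have : `|d| ^+ 2 <= (2 / 5) ^+ 2 by rewrite lerXn2r ?nnegrE// (le_trans dh).
by lra.
Qed.

Lemma arc_dist_mono (K l1 l2 c : R) : 0 < K ->
  1 + l1 ^+ 2 - 2 * l1 * c < 1 + l2 ^+ 2 - 2 * l2 * c ->
  0 <= 1 + l1 ^+ 2 - 2 * l1 * c ->
  arc_dist K l1 c < arc_dist K l2 c.
Proof.
move=> K0 l12 l0; rewrite ltr_sqrt ?ltr_pM2l ?exprn_gt0//.
by rewrite mulr_gt0 ?exprn_gt0// (le_lt_trans l0).
Qed.

Lemma arc_dist_ge (K l c b : R) : 0 < K -> 0 <= b ->
  b ^+ 2 <= 1 + l ^+ 2 - 2 * l * c -> K * b <= arc_dist K l c.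
Proof.
move=> K0 b0 h; have Kb : 0 <= K * b by rewrite mulr_ge0// ltW.
by rewrite -[leLHS](ger0_norm Kb) -sqrtr_sqr ler_wsqrtr// exprMn ler_pM2l// exprn_gt0.
Qed.

Lemma arc_dist_le (K l c b : R) : 0 < K -> 0 <= b ->
  1 + l ^+ 2 - 2 * l * c <= b ^+ 2 -> arc_dist K l c <= K * b.
Proof.
move=> K0 b0 h; have Kb : 0 <= K * b by rewrite mulr_ge0// ltW.
by rewrite -[leRHS](ger0_norm Kb) -sqrtr_sqr ler_wsqrtr// exprMn ler_pM2l// exprn_gt0.
Qed.

(** The two sources are at distance pi / 2 after scaling by k, so the triangle
    inequality bounds the gap by pi / 2; the comparison exponent is q = 3 / 2. *)
Lemma cross_product_high (K c : R) : 6 * pi <= K -> 7 / 10 <= c <= 1 ->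
  0 < arc_dist K (1 / 2) c /\ 0 < arc_dist K (1 / 2 + pi / (2 * K)) c /\
  cross_product (arc_dist K (1 / 2) c) (arc_dist K (1 / 2 + pi / (2 * K)) c) != 0.
Proof.
move=> K6 /andP[c7 c1].
have pi2 := pi_ge2 R.
have pi0 := pi_gt0 R.
have K0 : 0 < K by move: K6 pi0; move: (pi : R) => p; lra.
pose p := pi / K.
have Kp : K * p = pi by rewrite /p mulrC divfK// gt_eqF.
have p0 : 0 < p by rewrite divr_gt0.
have p6 : 6 * p <= 1.
  by rewrite /p mulrA ler_pdivrMr// mul1r.
have -> : pi / (2 * K) = p / 2 by rewrite /p invfM mulrCA mulrC.
pose l := 1 / 2 + p / 2.
set A1 := arc_dist K (1 / 2) c; set A2 := arc_dist K _ c.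
have A2_ge : K * (1 - l) <= A2.
  apply: arc_dist_ge => //; rewrite /l; first lra.
  have : 0 <= 2 * l * (1 - c) by rewrite !mulr_ge0// /l; lra.
  rewrite /l; lra.
have A2_ge1 : 1 <= A2.
  apply: le_trans A2_ge; rewrite /l.
  have -> : K * (1 - (1 / 2 + p / 2)) = K / 2 - (K * p) / 2 by field.
  by rewrite Kp; move: K6 pi2; move: (pi : R) => q; lra.
have A21 : A2 < A1.
  apply: arc_dist_mono => //.
    rewrite -subr_gt0 (_ : _ - _ = p / 2 * (2 * c - 1 - p / 2)); last by field.
    by rewrite mulr_gt0//; lra.
  have -> : 1 + (1 / 2 + p / 2) ^+ 2 - 2 * (1 / 2 + p / 2) * c =
      (l - c) ^+ 2 + (1 - c) * (1 + c).
    by rewrite /l; field.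
  by rewrite addr_ge0 ?sqr_ge0// mulr_ge0//; lra.
have gap : A1 - A2 <= pi / 2.
  pose B2 := Num.sqrt (1 + l ^+ 2 - 2 * l * c).
  have B2E : A2 = K * B2.
    by rewrite /A2 /arc_dist sqrtrM ?sqr_ge0// sqrtr_sqr gtr0_norm.
  have rad0 : 0 <= 1 + l ^+ 2 - 2 * l * c.
    have -> : 1 + l ^+ 2 - 2 * l * c = (l - c) ^+ 2 + (1 - c) * (1 + c) by ring.
    by rewrite addr_ge0 ?sqr_ge0// mulr_ge0//; lra.
  have B2c : c - l <= B2.
    apply: (le_trans (ler_norm _)); rewrite -sqrtr_sqr ler_wsqrtr//.
    have : 0 <= (1 - c) * (1 + c) by rewrite mulr_ge0//; lra.
    by lra.
  have sB2 : B2 ^+ 2 = 1 + l ^+ 2 - 2 * l * c by rewrite sqr_sqrtr.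
  have B20 : 0 <= B2 by rewrite sqrtr_ge0.
  have : A1 <= K * (B2 + p / 2).
    apply: arc_dist_le => //; first by rewrite addr_ge0// ltW// divr_gt0.
    rewrite sqrrD sB2 -subr_ge0.
    rewrite (_ : _ - _ = p * (B2 - (c - l))); last by rewrite /l; field.
    by rewrite mulr_ge0 ?subr_ge0// ltW.
  rewrite mulrDr -B2E mulrA Kp; lra.
have A20 : 0 < A2 by rewrite (lt_le_trans _ A2_ge1).
split; first exact: lt_trans A21.
split => //.
have : cross_product A2 A1 != 0.
  apply: (@cross_product_neq0 _ A2 A1 (3 / 2)) => //.
    by move: gap pi0; move: (pi : R) => q; lra.
  have : (4 * A2 ^+ 2)^-1 <= 4^-1.
    by rewrite lef_pV2 ?posrE ?mulr_gt0 ?exprn_gt0// ler_peMr// exprn_ege1.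
  by lra.
by rewrite -oppr_eq0 /cross_product opprB.
Qed.

(** Here K = k* R = pi / 5.  By the triangle inequality the scaled distances lie
    in [K / 2, 5 K / 2] = [pi / 10, pi / 2], and q = 12 / 5 satisfies both
    q (2 pi / 5) < pi and q^2 > 1 + 25 / pi^2. *)
Lemma cross_product_low (c : R) : 7 / 10 <= c <= 1 ->
  let K := pi / 5 in
  0 < arc_dist K (1 / 2) c /\ 0 < arc_dist K (- (3 / 2)) c /\
  cross_product (arc_dist K (1 / 2) c) (arc_dist K (- (3 / 2)) c) != 0.
Proof.
move=> /andP[c7 c1] K.
have pi0 := pi_gt0 R.
have K0 : 0 < K by rewrite divr_gt0.
set A1 := arc_dist K (1 / 2) c; set A2 := arc_dist K _ c.
have A1_ge : K * (1 / 2) <= A1 by apply: arc_dist_ge => //; lra.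
have A2_le : A2 <= K * (5 / 2) by apply: arc_dist_le => //; lra.
have A12 : A1 < A2 by apply: arc_dist_mono => //; lra.
have A10 : 0 < A1 by apply: lt_le_trans A1_ge; rewrite mulr_gt0.
split => //; split; first exact: lt_trans A12.
apply: (@cross_product_neq0 _ A1 A2 (12 / 5)) => //.
  by move: A1_ge A2_le; rewrite /K; move: (pi : R) pi0 => q; lra.
have A1q0 : (K * (1 / 2)) ^+ 2 <= A1 ^+ 2.
  by rewrite lerXn2r ?nnegrE ?(ltW A10)// mulr_ge0// ltW.
have := @pi_sqr_ge8 R; rewrite /K in A1q0 *; move: (pi : R) A1q0 => q A1q q8.
have : (4 * A1 ^+ 2)^-1 <= (32 / 100)^-1.
  rewrite lef_pV2 ?posrE ?mulr_gt0 ?exprn_gt0//.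
  have : (q / 5 * (1 / 2)) ^+ 2 = q ^+ 2 / 100 by field.
  by lra.
by lra.
Qed.

End geometry.

(** * The stability constant *)

Section constant.
Context {R : realType}.

Lemma has_deriv_continuous (f : R -> R) x v : has_deriv f x v ->
  {for x, continuous f}.
Proof.
by case=> fx _; apply/differentiable_continuous; rewrite -derivable1_diffP.
Qed.

Lemma continuous_besselJ0 : continuous (@besselJ0 R).
Proof. by move=> t; apply: has_deriv_continuous (has_deriv_besselJ0 t). Qed.

Lemma continuous_besselY0 (t : R) : 0 < t -> {for t, continuous (@besselY0 R)}.
Proof. by move=> t0; apply: has_deriv_continuous (has_deriv_besselY0 t0). Qed.

Lemma continuous_arc_dist (rad lam : R) : continuous (arc_dist rad lam).
Proof.
move=> c; apply: (@continuous_comp _ _ _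
  (fun c => rad ^+ 2 * (1 + lam ^+ 2 - 2 * lam * c)) (@Num.sqrt R)); last first.
  exact: sqrt_continuous.
have := @has_deriv_continuous
  (fun c => rad ^+ 2 * ((1 + lam ^+ 2) + - (2 * lam * c))) c.
apply; apply: has_derivZ; apply: has_derivD; first exact: has_deriv_cst.
by apply: has_derivN; apply: has_derivZ; exact: has_deriv_id.
Qed.

Definition bessel_size (s t : R) : R :=
  (`|besselJ0 s| + `|besselJ0 t|) + (`|besselY0 s| + `|besselY0 t|).

(** C controls the norm of the inverse of the system, uniformly in the
    position of the observation point on the arc. *)
Definition amplification_bound (k rad lam2 C : R) : Prop :=
  0 < C /\ forall c, 7 / 10 <= c <= 1 ->
    bessel_size (arc_dist (k * rad) (1 / 2) c) (arc_dist (k * rad) lam2 c) <=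
    C * `|cross_product (arc_dist (k * rad) (1 / 2) c) (arc_dist (k * rad) lam2 c)|.

Lemma amplification_bound_exists (k rad lam2 : R) :
  (forall c, 7 / 10 <= c <= 1 ->
    0 < arc_dist (k * rad) (1 / 2) c /\ 0 < arc_dist (k * rad) lam2 c /\
    cross_product (arc_dist (k * rad) (1 / 2) c) (arc_dist (k * rad) lam2 c) != 0) ->
  exists C, amplification_bound k rad lam2 C.
Proof.
move=> H; pose s := arc_dist (k * rad) (1 / 2); pose t := arc_dist (k * rad) lam2.
pose h c := bessel_size (s c) (t c) / `|cross_product (s c) (t c)|.
have ch : {within `[7 / 10, 1], continuous h}.
  apply: continuous_in_subspaceT => c; rewrite inE/= in_itv/= => /H[s0 [t0 D0]].
  have Js : (besselJ0 (s x) @[x --> c] --> besselJ0 (s c)).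
    by apply: continuous_comp; [exact: continuous_arc_dist|exact: continuous_besselJ0].
  have Jt : (besselJ0 (t x) @[x --> c] --> besselJ0 (t c)).
    by apply: continuous_comp; [exact: continuous_arc_dist|exact: continuous_besselJ0].
  have Ys : (besselY0 (s x) @[x --> c] --> besselY0 (s c)).
    by apply: continuous_comp; [exact: continuous_arc_dist|exact: continuous_besselY0].
  have Yt : (besselY0 (t x) @[x --> c] --> besselY0 (t c)).
    by apply: continuous_comp; [exact: continuous_arc_dist|exact: continuous_besselY0].
  apply: cvgM.
    by apply: cvgD; apply: cvgD; apply: cvg_norm.
  apply: cvgV; first by rewrite normr_eq0.
  by apply: cvg_norm; apply: cvgB; apply: cvgM.
have [|c0 _ hmax] := EVT_max _ ch; first lra.
exists (`|h c0| + 1); split; first by rewrite ltr_wpDl.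
move=> c cI; have [s0 [t0 D0]] := H c cI.
rewrite -ler_pdivrMr ?normr_gt0//.
have /hmax hc : c \in `[7 / 10, 1]%R by rewrite in_itv.
by apply: le_trans hc _; rewrite (le_trans (ler_norm _))// lerDl.
Qed.

(** Cramer's rule. *)
Lemma two_by_two_bound (J1 J2 Y1 Y2 e1 e2 F1 F2 : R) :
  Y1 * e1 - J1 * e2 = F1 -> Y2 * e1 - J2 * e2 = F2 ->
  `|J1 * Y2 - J2 * Y1| * (`|e1| + `|e2|) <=
  ((`|J1| + `|J2|) + (`|Y1| + `|Y2|)) * (`|F1| + `|F2|).
Proof.
move=> E1 E2; rewrite mulrDr -!normrM.
have -> : (J1 * Y2 - J2 * Y1) * e1 = J1 * F2 - J2 * F1 by rewrite -E1 -E2; ring.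
have -> : (J1 * Y2 - J2 * Y1) * e2 = Y1 * F2 - Y2 * F1 by rewrite -E1 -E2; ring.
rewrite mulrDl; apply: lerD; apply: (le_trans (ler_normB _ _)); rewrite !normrM.
  have := mulr_ge0 (normr_ge0 J1) (normr_ge0 F1).
  have := mulr_ge0 (normr_ge0 J2) (normr_ge0 F2).
  by lra.
have := mulr_ge0 (normr_ge0 Y1) (normr_ge0 F1).
have := mulr_ge0 (normr_ge0 Y2) (normr_ge0 F2).
by lra.
Qed.

Lemma two_by_two_stability (J1 J2 Y1 Y2 e1 e2 p1 p2 q : R) :
  Y1 * e1 - J1 * e2 = 2 * (p1 - q) -> Y2 * e1 - J2 * e2 = 2 * (p2 - q) ->
  `|J1 * Y2 - J2 * Y1| * (`|e1| + `|e2|) <=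
  ((`|J1| + `|J2|) + (`|Y1| + `|Y2|)) * (4 * (`|p1| + `|p2| + `|q|)).
Proof.
move=> E1 E2; apply: le_trans (two_by_two_bound E1 E2) _.
rewrite ler_wpM2l ?addr_ge0// !normrM ger0_norm//.
have := ler_normB p1 q; have := ler_normB p2 q.
have := normr_ge0 p1; have := normr_ge0 p2; lra.
Qed.

Lemma sum_ord2 (F : 'I_2 -> R) :
  \sum_(l < 2) F l = F ord0 + F (lift ord0 ord0).
Proof. by rewrite !big_ord_recl big_ord0 addr0. Qed.

Lemma norm2_le (x : R * R) : norm2 x <= `|x.1| + `|x.2|.
Proof.
rewrite /norm2 -[leRHS]ger0_norm ?addr_ge0// -sqrtr_sqr ler_wsqrtr//.
rewrite sqrrD !real_normK ?num_real// addrAC lerDl.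
by rewrite mulrn_wge0// mulr_ge0.
Qed.

End constant.

(** * Square integrability *)

Section square_integrable.
Context {R : realType}.

Lemma Lfun2_sqr_integrable d (T : measurableType d)
    (mu : {measure set T -> \bar R}) (f : T -> R) :
  measurable_fun setT f -> mu.-integrable setT (EFin \o (fun x => f x ^+ 2)) ->
  f \in Lfun mu 2%:E.
Proof.
move=> mf /integrableP[_ foo]; rewrite inE; apply/andP; split; rewrite inE//=.
rewrite /finite_norm unlock poweR_lty//.
apply: le_lt_trans foo; rewrite le_eqVlt; apply/orP; left; apply/eqP.
apply: eq_integral => x _ /=.
by rewrite powR_mulrn// normrX.
Qed.

Lemma measurable_Omega0 (a : R) :
  measurable (Omega0 a : set (measurableTypeR R * measurableTypeR R)) /\
  (leb2 R (Omega0 a) < +oo)%E.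
Proof.
pose I : set (measurableTypeR R) := `]- a, a[%classic.
have -> : Omega0 a = I `*` I.
  by apply/seteqP; split => y /=; rewrite /I/= !in_itv/=.
have mI : measurable I by exact: measurable_itv.
split; first exact: measurableX.
have -> : leb2 R (I `*` I) = (lebesgue_measure I * lebesgue_measure I)%E.
  exact: product_measure1E.
rewrite lebesgue_measure_itv/=.
by case: ifPn => _; rewrite ?mul0e// -EFinB -EFinM ltry.
Qed.

(** On a set of finite measure L^4 is contained in L^2. *)
Lemma Lfun2_bounded_mul_Lfun4 d (T : measurableType d)
    (mu : {measure set T -> \bar R}) (D : set T) (B : R) (phi sigma : T -> R) :
  measurable D -> (mu D < +oo)%E -> measurable_fun setT phi ->
  (forall y, D y -> `|phi y| <= B) -> sigma \in Lfun mu 4%:E ->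
  ((fun y => phi y * sigma y) \_ D) \in Lfun mu 2%:E.
Proof.
move=> mD Doo mphi phiB s4.
have ms : measurable_fun setT sigma by move: s4; rewrite inE => /andP[]; rewrite inE.
have mh : measurable_fun setT ((fun y => phi y * sigma y) \_ D).
  apply: (measurable_restrictT _ mD).1; apply: measurable_funTS.
  exact: measurable_funM.
apply: Lfun2_sqr_integrable => //.
have i4 : mu.-integrable setT (fun y => (`|sigma y| `^ 4)%:E).
  by apply: Lfun_integrable => //; rewrite ler1n.
have i1 : mu.-integrable setT (EFin \o \1_D).
  apply/integrableP; split; first by apply/measurable_EFinP; exact: measurable_indic.
  under eq_integral => y _ do rewrite gee0_abs ?lee_fin//.
  by rewrite integral_indic// setIT.
apply: (@le_integrable _ _ _ _ _ measurableT _
    (fun y => (B ^+ 2)%:E * ((\1_D y)%:E + (`|sigma y| `^ 4)%:E))%E).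
- by apply/measurable_EFinP; exact: measurable_funX.
- move=> y _ /=; rewrite lee_fin.
  rewrite [leLHS]ger0_norm ?sqr_ge0// [leRHS]ger0_norm; last first.
    by rewrite mulr_ge0 ?sqr_ge0// addr_ge0// powR_ge0.
  rewrite patchE indicE; case: ifPn => [/set_mem yO|_]; last first.
    by rewrite expr0n/= mulr_ge0 ?sqr_ge0// addr_ge0// powR_ge0.
  rewrite exprMn ler_pM ?sqr_ge0//.
    by rewrite -real_normK ?num_real// lerXn2r ?nnegrE// ?phiB// (le_trans _ (phiB _ yO)).
  (* s <= 1 + s^2 with s = sigma(y)^2 *)
  rewrite powR_mulrn// -normrX ger0_norm; last by rewrite (exprM _ 2 2) sqr_ge0.
  rewrite (exprM _ 2 2) -subr_ge0.
  have := sqr_ge0 (sigma y ^+ 2 - 1); have := sqr_ge0 (sigma y ^+ 2).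
  set s := sigma y ^+ 2; rewrite sqrrB => h1 h2; have : 0 <= s by exact: sqr_ge0.
  rewrite /= -mulr_natl; lra.
- by apply: integrableZl => //; exact: integrableD.
Qed.

End square_integrable.

(** * Means and white noise integrals *)

Section expectations.
Context d (T : measurableType d) {R : realType} (P : probability T R).

Definition mean (X : T -> R) : R := fine 'E_P[X].

Lemma meanD (X Y : T -> R) : X \in Lfun P 1 -> Y \in Lfun P 1 ->
  mean (fun w => X w + Y w) = mean X + mean Y.
Proof.
move=> X1 Y1; rewrite /mean -fineD ?expectation_fin_num//.
by rewrite -expectationD.
Qed.

Lemma meanZ (X : T -> R) c : X \in Lfun P 1 ->
  mean (fun w => c * X w) = c * mean X.
Proof.
move=> X1; rewrite /mean -[c in RHS]/(fine c%:E) -fineM ?expectation_fin_num//.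
rewrite -expectationZl//; congr (fine (expectation _ _)).
by apply/funext => w /=; rewrite mulrC.
Qed.

Lemma mean_cst c : mean (fun=> c) = c.
Proof. by rewrite /mean (expectation_cst P c). Qed.

Lemma Lfun1Z (X : T -> R) c : X \in Lfun P 1 -> (fun w => c * X w) \in Lfun P 1.
Proof.
move=> X1; rewrite (_ : (fun w => _) = c \o* X); last first.
  by apply/funext => w /=; rewrite mulrC.
exact: Lfun_scale.
Qed.

Lemma Lfun1D (X Y : T -> R) : X \in Lfun P 1 -> Y \in Lfun P 1 ->
  (fun w => X w + Y w) \in Lfun P 1.
Proof.
move=> /Lfun1_integrable X1 /Lfun1_integrable Y1; apply/Lfun1_integrable.
have := integrableD measurableT X1 Y1.
by apply: eq_integrable.
Qed.

Lemma Lfun1_cst c : (fun=> c) \in Lfun P 1.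
Proof. exact: (Lfun_cst P c 1). Qed.

Lemma Lfun21 (X : T -> R) : X \in Lfun P 2%:E -> X \in Lfun P 1.
Proof.
by move=> X2; apply: Lfun_subset12 X2; rewrite fin_num_measure.
Qed.

Lemma Lfun2_sqr (X : T -> R) : X \in Lfun P 2%:E ->
  (fun w => X w * X w) \in Lfun P 1.
Proof. by move=> X2; exact: Lfun2_mul_Lfun1. Qed.

Lemma mean_sqr_shift (X Y : T -> R) (a b : R) :
  X \in Lfun P 2%:E -> Y \in Lfun P 2%:E ->
  mean (fun w => (X w + a) ^+ 2 + (Y w + b) ^+ 2) =
  mean (fun w => X w ^+ 2 + Y w ^+ 2) +
  (2 * a * mean X + 2 * b * mean Y + (a ^+ 2 + b ^+ 2)).
Proof.
move=> X2 Y2; have X1 := Lfun21 X2; have Y1 := Lfun21 Y2.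
have XX := Lfun2_sqr X2; have YY := Lfun2_sqr Y2.
transitivity (mean (fun w => (X w * X w + Y w * Y w) +
   ((2 * a * X w + 2 * b * Y w) + (a ^+ 2 + b ^+ 2)))).
  by congr mean; apply/funext => w; ring.
have XY := Lfun1D (Lfun1Z (2 * a) X1) (Lfun1Z (2 * b) Y1).
rewrite (meanD (Lfun1D XX YY) (Lfun1D XY (Lfun1_cst _))).
rewrite (meanD XY (Lfun1_cst _)) (meanD (Lfun1Z _ X1) (Lfun1Z _ Y1)).
by rewrite (meanZ _ X1) (meanZ _ Y1) mean_cst.
Qed.

Lemma Lfun2_shift (X : T -> R) c : X \in Lfun P 2%:E ->
  (fun w => c + X w) \in Lfun P 2%:E.
Proof.
move=> X2; have mX : measurable_fun setT X.
  by move: X2; rewrite inE => /andP[]; rewrite inE.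
apply: Lfun2_sqr_integrable; first exact: measurable_funD.
apply/Lfun1_integrable.
rewrite (_ : (fun w => _) = fun w => X w * X w + (2 * c * X w + c ^+ 2)); last first.
  by apply/funext => w; ring.
apply: Lfun1D; first exact: Lfun2_sqr.
by apply: Lfun1D; [apply: Lfun1Z; exact: Lfun21|exact: Lfun1_cst].
Qed.

(** By the Ito isometry, E[W(h)^2] is the squared L^2 norm of h, which is finite. *)
Lemma white_noise_Lfun2 (W : (R * R -> R) -> {RV P >-> R}) h :
  white_noise W -> L2 h -> (W h : T -> R) \in Lfun P 2%:E.
Proof.
move=> [_ _ cov] h2; apply: Lfun2_sqr_integrable => //.
have mW : measurable_fun setT (EFin \o (fun w => W h w ^+ 2)).
  by apply/measurable_EFinP; exact: measurable_funX.
apply/integrableP; split => //.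
have /integrableP[_ hoo] := Lfun2_integrable_sqr h2.
apply: le_lt_trans hoo; rewrite le_eqVlt; apply/orP; left; apply/eqP.
have := cov _ _ h2 h2; rewrite unlock => E.
transitivity (\int[P]_w (W h w * W h w)%:E)%E.
  by apply: eq_integral => w _; rewrite gee0_abs ?lee_fin ?sqr_ge0.
rewrite E; apply: eq_integral => y _.
by rewrite gee0_abs ?lee_fin ?sqr_ge0.
Qed.

Lemma normc_sqr (z : R[i]) :
  ComplexField.Normc.normc z ^+ 2 = complex.Re z ^+ 2 + complex.Im z ^+ 2.
Proof. by case: z => a b /=; rewrite sqr_sqrtr// addr_ge0 ?sqr_ge0. Qed.

(** Interference with a deterministic field z reveals a linear combination of the
    means that the intensity alone does not contain. *)
Lemma mean_sq_shift (X : T -> R[i]) (z : R[i]) :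
  (fun w => complex.Re (X w)) \in Lfun P 2%:E ->
  (fun w => complex.Im (X w)) \in Lfun P 2%:E ->
  mean_sq P (fun w => X w + z) = mean_sq P X +
   (2 * complex.Re z * (mean_ReIm P X).1 + 2 * complex.Im z * (mean_ReIm P X).2
     + ComplexField.Normc.normc z ^+ 2).
Proof.
move=> X2 Y2; rewrite /mean_ReIm /= -![fine _]/(mean _) normc_sqr.
have := mean_sqr_shift (complex.Re z) (complex.Im z) X2 Y2.
rewrite /mean_sq -![fine _]/(mean _) => E.
transitivity (mean (fun w => (complex.Re (X w) + complex.Re z) ^+ 2 +
   (complex.Im (X w) + complex.Im z) ^+ 2)).
  congr mean; apply/funext => w; rewrite normc_sqr.
  by move: (X w) z {E} => [p q] [r s].
rewrite E; congr (_ + _); congr mean; apply/funext => w.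
by rewrite normc_sqr.
Qed.

End expectations.

Section green_function.
Context {R : realType}.

Lemma greenE (k : R) (x y : R * R) : green k x y =
  Complex (besselY0 (k * dist2 x y) / 4) (- (besselJ0 (k * dist2 x y) / 4)).
Proof.
rewrite /green /hankel0.
have -> : (4 : R[i])^-1 = (4^-1 : R)%:C%C by rewrite fmorphV rmorph_nat.
by apply/eqP; rewrite eq_complex /=; apply/andP; split; apply/eqP; ring.
Qed.

End green_function.

(** * The radiated field *)

Section radiated_field.
Context {R : realType}.
Implicit Types (x y : R * R).

Lemma bounded_on_segment (f : R -> R) (u v : R) : u <= v ->
  (forall t, u <= t <= v -> {for t, continuous f}) ->
  exists B, forall t, u <= t <= v -> `|f t| <= B.
Proof.
move=> uv cf.
have cnf : {within `[u, v], continuous (fun t => `|f t|)}.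
  apply: continuous_in_subspaceT => t; rewrite inE/= in_itv/= => tuv.
  by apply: cvg_norm; exact: cf.
have [c _ fc] := EVT_max uv cnf.
by exists `|f c| => t tuv; apply: fc; rewrite in_itv.
Qed.

Lemma measurable_besselJ0 : measurable_fun setT (@besselJ0 R).
Proof. exact: continuous_measurable_fun continuous_besselJ0. Qed.

Lemma measurable_besselY0 : measurable_fun setT (@besselY0 R).
Proof.
have mS : measurable_fun setT (@besselS R).
  apply: continuous_measurable_fun => t.
  exact: has_deriv_continuous (has_deriv_besselS t).
apply: measurable_funM => //; apply: measurable_funB; last exact: mS.
apply: measurable_funM; last exact: measurable_besselJ0.
apply: measurable_funD => //.
by apply: measurableT_comp; [exact: measurable_ln|exact: measurable_funM].
Qed.

Lemma measurable_dist2 x :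
  @measurable_fun _ _ (measurableTypeR R * measurableTypeR R)%type R setT (dist2 x).
Proof.
apply: (@measurableT_comp _ _ _ _ _ _ (@Num.sqrt R)).
  by apply: continuous_measurable_fun; exact: sqrt_continuous.
by apply: measurable_funD; apply: measurable_funX; exact: measurable_funB.
Qed.

(** Both bounds follow from (s - 2 t)^2 >= 0 and (s + t)^2 >= 0 in each coordinate. *)
Lemma dist2_Omega0 (a : R) x y : 0 < a -> 36 * a ^+ 2 <= x.1 ^+ 2 + x.2 ^+ 2 ->
  Omega0 a y ->
  4 * a <= dist2 x y <= Num.sqrt (2 * (x.1 ^+ 2 + x.2 ^+ 2) + 4 * a ^+ 2).
Proof.
move=> a0 xa [y1 y2].
have sq (t : R) : - a < t < a -> t ^+ 2 <= a ^+ 2.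
  by move=> ta; rewrite -subr_ge0 subr_sqr mulr_ge0//; lra.
have h1 := sq _ y1; have h2 := sq _ y2.
have le2 (s t : R) : s ^+ 2 <= 2 * (s - t) ^+ 2 + 2 * t ^+ 2.
  rewrite -subr_ge0 (_ : _ - _ = (s - 2 * t) ^+ 2); last by ring.
  exact: sqr_ge0.
have ge2 (s t : R) : (s - t) ^+ 2 <= 2 * s ^+ 2 + 2 * t ^+ 2.
  rewrite -subr_ge0 (_ : _ - _ = (s + t) ^+ 2); last by ring.
  exact: sqr_ge0.
rewrite /dist2 /norm2 /=; apply/andP; split.
  have a4 : 0 <= 4 * a by rewrite mulr_ge0// ltW.
  rewrite -(ger0_norm a4) -sqrtr_sqr ler_wsqrtr//.
  by have := le2 x.1 y.1; have := le2 x.2 y.2; rewrite exprMn; lra.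
by rewrite ler_wsqrtr//; have := ge2 x.1 y.1; have := ge2 x.2 y.2; lra.
Qed.

(** For y in the square, |x - y| ranges in a compact subset of the positive reals, so a
    kernel that is singular only at the origin is bounded there. *)
Lemma L2_radial_mul (f : R -> R) (a k : R) (sigma : R * R -> R) x :
  0 < a -> 0 < k -> 36 * a ^+ 2 <= x.1 ^+ 2 + x.2 ^+ 2 -> L4 sigma ->
  measurable_fun setT f -> (forall t, 0 < t -> {for t, continuous f}) ->
  L2 ((fun y => f (k * dist2 x y) * sigma y) \_ (Omega0 a)).
Proof.
move=> a0 k0 xa s4 mf cf.
pose N := Num.sqrt (2 * (x.1 ^+ 2 + x.2 ^+ 2) + 4 * a ^+ 2).
have O0 : Omega0 a (0, 0) by split => /=; rewrite oppr_lt0 a0.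
have [||B fB] := @bounded_on_segment f (k * (4 * a)) (k * N).
- by have /andP[l u] := dist2_Omega0 a0 xa O0; rewrite ler_pM2l// (le_trans l).
- by move=> t /andP[lt _]; apply: cf; apply: lt_le_trans lt; rewrite !mulr_gt0.
have [mO Ooo] := measurable_Omega0 a.
apply: (@Lfun2_bounded_mul_Lfun4 _ _ _ _ _ B _ _ mO Ooo _ _ s4).
  apply: measurableT_comp => //; apply: measurable_funM => //.
  exact: measurable_dist2.
move=> y /(dist2_Omega0 a0 xa) /andP[l u].
by apply: fB; rewrite !ler_pM2l// l.
Qed.

Lemma radiated_field_Lfun2 d (T : measurableType d) (P : probability T R)
    (W : (R * R -> R) -> {RV P >-> R}) (a k : R) (g sigma : R * R -> R) x :
  0 < a -> 0 < k -> 36 * a ^+ 2 <= x.1 ^+ 2 + x.2 ^+ 2 -> L4 sigma ->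
  white_noise W ->
  (fun w => complex.Re (radiated_field W a g sigma k x w)) \in Lfun P 2%:E /\
  (fun w => complex.Im (radiated_field W a g sigma k x w)) \in Lfun P 2%:E.
Proof.
move=> a0 k0 xa s4 wn; rewrite /radiated_field /cintegral /cstochastic_integral.
split; apply: Lfun2_shift; apply: white_noise_Lfun2 => //.
  have := @L2_radial_mul (fun t => besselY0 t / 4) a k sigma x a0 k0 xa s4.
  rewrite (_ : (fun y => complex.Re (green k x y * (sigma y)%:C%C)) =
      fun y => besselY0 (k * dist2 x y) / 4 * sigma y); last first.
    by apply/funext => y; rewrite greenE /=; ring.
  apply.
    by apply: measurable_funM => //; exact: measurable_besselY0.
  by move=> t t0; apply: cvgM; [exact: continuous_besselY0|exact: cvg_cst].
have := @L2_radial_mul (fun t => - (besselJ0 t / 4)) a k sigma x a0 k0 xa s4.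
rewrite (_ : (fun y => complex.Im (green k x y * (sigma y)%:C%C)) =
    fun y => - (besselJ0 (k * dist2 x y) / 4) * sigma y); last first.
  by apply/funext => y; rewrite greenE /=; ring.
apply.
  by apply: measurable_funN; apply: measurable_funM => //; exact: measurable_besselJ0.
by move=> t t0; apply: cvgN; apply: cvgM; [exact: continuous_besselJ0|exact: cvg_cst].
Qed.

Lemma exact_phaseless_system d (T : measurableType d) (P : probability T R)
    (W : (R * R -> R) -> {RV P >-> R}) (a k : R) (g sigma : R * R -> R) x z :
  0 < a -> 0 < k -> 36 * a ^+ 2 <= x.1 ^+ 2 + x.2 ^+ 2 -> L4 sigma ->
  white_noise W ->
  let u := radiated_field W a g sigma k x in
  besselY0 (k * dist2 x z) * (mean_ReIm P u).1
  - besselJ0 (k * dist2 x z) * (mean_ReIm P u).2 =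
  2 * (mean_sq P (fun w => u w + green k x z) - mean_sq P u)
  - 1 / 8 * ComplexField.Normc.normc (hankel0 (k * dist2 x z)) ^+ 2.
Proof.
move=> a0 k0 xa s4 wn u.
have [u1 u2] := radiated_field_Lfun2 g a0 k0 xa s4 wn.
rewrite (mean_sq_shift _ u1 u2) !normc_sqr greenE /=.
by field.
Qed.

Lemma kstar_obs_radius (a tau : R) : 0 < a ->
  kstar a * obs_radius a tau (kstar a) = pi / 5.
Proof.
move=> a0; rewrite /obs_radius eqxx /kstar; move: (pi : R) => p.
by field; rewrite gt_eqF.
Qed.

Lemma wave_numbers_cross_product (a tau k : R) : 0 < a -> 6 <= tau ->
  wave_numbers a k ->
  [/\ 0 < k, 6 * a <= obs_radius a tau k &
  forall c, 7 / 10 <= c <= 1 ->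
  let s := arc_dist (k * obs_radius a tau k) (1 / 2) c in
  let t := arc_dist (k * obs_radius a tau k) (lambda2 a tau k) c in
  0 < s /\ 0 < t /\ cross_product s t != 0].
Proof.
move=> a0 tau6 kN; have pi0 := pi_gt0 R.
have ks0 : 0 < kstar a by rewrite divr_gt0// mulr_gt0.
have [kE|kneq] := eqVneq k (kstar a).
  rewrite kE; split=> //; first by rewrite /obs_radius eqxx.
  move=> c cI; rewrite kstar_obs_radius// /lambda2 eqxx.
  exact: cross_product_low.
case: kN => [[t /= t1 kE]|/eqP]; last by rewrite (negbTE kneq).
have k0 : 0 < k by rewrite -kE mulr_gt0 ?divr_gt0// (lt_le_trans ltr01).
rewrite /lambda2 /obs_radius (negbTE kneq); split => //.
  by rewrite ler_pM2r.
move=> c cI; rewrite -(mulrA 2); apply: cross_product_high => //.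
rewrite -kE (_ : pi / a * t * (tau * a) = pi * (t * tau)); last first.
  by move: (pi : R) => p; field; rewrite gt_eqF.
rewrite mulrC ler_pM2l//.
have : 0 <= (t - 1) * tau by rewrite mulr_ge0 ?subr_ge0//; lra.
by lra.
Qed.

End radiated_field.

Theorem theorem2p3 (R : realType) :
  exists C : R -> R -> R -> R -> R -> R,
    (forall k rad M Ms lam2 : R, 0 < C k rad M Ms lam2) /\
    forall (a tau k : R) (m j : nat),
      0 < a -> 6 <= tau -> (10 <= m)%N -> (1 <= j <= m)%N -> wave_numbers a k ->
    forall g sigma : R * R -> R,
      compact_support_in (Omega0 a) g ->
      compact_support_in (Omega0 a) sigma ->
      (forall y, 0 <= sigma y) -> L2 g -> L4 sigma ->
    forall (d : measure_display) (T : measurableType d) (P : probability T R)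
      (W : (R * R -> R) -> {RV P >-> R}), white_noise W ->
    let rad := obs_radius a tau k in
    let dB := obs_arc rad m j in
    let z (l : 'I_2) := point_source rad (source_lambda a tau k l) m j in
    let r (l : 'I_2) (x : R * R) := dist2 x (z l) in
    let u (x : R * R) (w : T) := radiated_field W a g sigma k x w in
    let v (l : 'I_2) (x : R * R) (w : T) := u x w + green k x (z l) in
    forall (Eu : R * R -> R) (Ev : 'I_2 -> R * R -> R) (Em : R * R -> R * R),
      let f (l : 'I_2) (x : R * R) :=
        2 * (Ev l x - Eu x) - 1 / 8 * ComplexField.Normc.normc (hankel0 (k * r l x)) ^+ 2 in
      (forall x, dB x -> forall l : 'I_2,
        besselY0 (k * r l x) * (Em x).1 - besselJ0 (k * r l x) * (Em x).2
          = f l x) ->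
      forall x, dB x ->
        norm2 (Em x - mean_ReIm P (u x)) <=
          C k rad (Mpar tau) (Mstar R) (lambda2 a tau k) *
            (\sum_(l < 2) `|Ev l x - mean_sq P (v l x)|
             + `|Eu x - mean_sq P (u x)|).
Proof.
(* Any admissible constant will do; the default value 1 only keeps it positive
   for parameters at which the determinant may vanish. *)
pose C0 (k rad lam2 : R) : R := xget 1 [set C | amplification_bound k rad lam2 C].
exists (fun k rad _ _ lam2 => 4 * C0 k rad lam2); split.
  move=> k rad _ _ lam2; rewrite mulr_gt0// /C0.
  by case: xgetP => [c _ [+ _]|].
move=> a tau k m j a0 tau6 m10 /andP[j1 _] kN g sigma _ _ _ _ s4 d T P W wn.
move=> rad dB z r u v Eu Ev Em f sys x xB.
have [k0 rad6 cross] := wave_numbers_cross_product a0 tau6 kN.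
have [C1 C1b] := amplification_bound_exists cross.
have [C0_gt0 C0b] : amplification_bound k rad (lambda2 a tau k)
    (C0 k rad (lambda2 a tau k)).
  exact: (@xgetI _ 1 [set C | amplification_bound k rad (lambda2 a tau k) C] C1).
have [theta thetaI xE] := xB.
pose c := cos (theta - obs_angle R m (2 * j - 1)%N).
have cI : 7 / 10 <= c <= 1 by rewrite cos_le1 andbT; exact: cos_arc_ge.
have krE l : k * r l x = arc_dist (k * rad) (source_lambda a tau k l) c.
  by rewrite /r -xE dist2_polar arc_distZ.
have xa : 36 * a ^+ 2 <= x.1 ^+ 2 + x.2 ^+ 2.
  rewrite -xE /= !exprMn -mulrDr cos2Dsin2 mulr1.
  rewrite (_ : 36 * a ^+ 2 = (6 * a) ^+ 2); last by ring.
  by rewrite lerXn2r ?nnegrE// ?(le_trans _ rad6)// mulr_ge0// ltW.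
pose e1 := (Em x).1 - (mean_ReIm P (u x)).1.
pose e2 := (Em x).2 - (mean_ReIm P (u x)).2.
have residual l : besselY0 (k * r l x) * e1 - besselJ0 (k * r l x) * e2 =
    2 * ((Ev l x - mean_sq P (v l x)) - (Eu x - mean_sq P (u x))).
  have h1 := sys x xB l.
  have h2 := exact_phaseless_system g (z l) a0 k0 xa s4 wn.
  transitivity ((besselY0 (k * r l x) * (Em x).1 - besselJ0 (k * r l x) * (Em x).2)
    - (besselY0 (k * r l x) * (mean_ReIm P (u x)).1
       - besselJ0 (k * r l x) * (mean_ReIm P (u x)).2)).
    by rewrite /e1 /e2; ring.
  by rewrite h1 [X in _ - X]h2 /f -/(u x) -/(v l x) -/(r l x); ring.
have := two_by_two_stability (residual ord0) (residual (lift ord0 ord0)).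
rewrite !krE sum_ord2.
have -> : source_lambda a tau k ord0 = 1 / 2 by [].
have -> : source_lambda a tau k (lift ord0 ord0) = lambda2 a tau k by [].
have [_ [_ D0]] := cross c cI.
have := C0b c cI.
move: D0; rewrite -/rad /bessel_size.
set D := cross_product _ _; set N := (_ + _ + _ : R); set K := C0 _ _ _.
set S := (`|_| + `|_| + `|_| : R) => D0 NK h.
apply: (@le_trans _ _ (`|e1| + `|e2|)); first exact: norm2_le.
rewrite -(ler_pM2l (x := `|D|)) ?normr_gt0//; apply: (le_trans h).
rewrite [leRHS](_ : _ = K * `|D| * (4 * S)); last by ring.
by rewrite ler_wpM2r// mulr_ge0// !addr_ge0.
Qed.
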